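(* Let $L,d_{\mathrm{model}},d_h,H_Q,H_{KV}$ be positive integers with $d_h$ even, let $\pi:\{1,\dots,H_Q\}\to\{1,\dots,H_{KV}\}$ be any map, and let $W_Q\in\mathbb{R}^{d_{\mathrm{model}}\times(H_Qd_h)}$, $W_K,W_V\in\mathbb{R}^{d_{\mathrm{model}}\times(H_{KV}d_h)}$, $W_O\in\mathbb{R}^{(H_Qd_h)\times d_{\mathrm{model}}}$. Let $\Phi(p)\in\mathbb{R}^{d_h\times d_h}$, for positions $p$, be the rotary (RoPE) operators defined in the context. Let $S_1,\dots,S_{H_{KV}}\in O(d_h)$ be orthogonal matrices such that $S_j\Phi(p)=\Phi(p)S_j$ for all $j$ and all positions $p$, and set $$S_{KV}=\operatorname{blkdiag}(S_1,\dots,S_{H_{KV}}),\qquad U=\operatorname{blkdiag}(S_{\pi(1)},\dots,S_{\pi(H_Q)}).$$ Define the reparameterized weights $$W_Q'=W_QU,\qquad W_K'=W_KS_{KV},\qquad W_V'=W_VS_{KV},\qquad W_O'=U^\top W_O .$$ Then for every input $X\in\mathbb{R}^{L\times d_{\mathrm{model}}}$ the RoPE grouped-query attention output $Y'$ computed with $(W_Q',W_K',W_V',W_O')$ equals the output $Y$ computed with $(W_Q,W_K,W_V,W_O)$.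
   Context: RoPE operators: for fixed real frequencies $\omega_1,\dots,\omega_{d_h/2}$, $\Phi(p)=\operatorname{blkdiag}\big(R(\omega_1p),\dots,R(\omega_{d_h/2}p)\big)$, where $R(\varphi)=\begin{bmatrix}\cos\varphi&-\sin\varphi\\ \sin\varphi&\cos\varphi\end{bmatrix}$. $\operatorname{blkdiag}$ denotes the block-diagonal matrix with the given blocks. RoPE grouped-query attention output: given weights $(W_Q,W_K,W_V,W_O)$, the head assignment $\pi$, and input $X\in\mathbb{R}^{L\times d_{\mathrm{model}}}$ (row $p$ corresponding to position $p$), put $Q=XW_Q$, $K=XW_K$, $V=XW_V$ and partition the columns into consecutive blocks of width $d_h$: $Q=[Q_1\mid\cdots\mid Q_{H_Q}]$, $K=[K_1\mid\cdots\mid K_{H_{KV}}]$, $V=[V_1\mid\cdots\mid V_{H_{KV}}]$. Rotated queries and keys are defined row by row by $\widetilde Q_i[p,:]=Q_i[p,:]\,\Phi(p)^\top$ and $\widetilde K_j[p,:]=K_j[p,:]\,\Phi(p)^\top$. For each $i$ let $A_i=\mathrm{softmax}\big(\tfrac{1}{\sqrt{d_h}}\widetilde Q_i\widetilde K_{\pi(i)}^\top\big)$ (softmax applied row-wise) and $O_i=A_iV_{\pi(i)}$. The output is $Y=[O_1\mid\cdots\mid O_{H_Q}]\,W_O$. *)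

(* Defs.v *)
From mathcomp Require Import all_boot all_order all_algebra.
From mathcomp Require Import reals sequences trigo.

Set Implicit Arguments.
Unset Strict Implicit.
Unset Printing Implicit Defensive.

Import Order.TTheory GRing.Theory Num.Theory.
Local Open Scope ring_scope.

Lemma sum_blocks (H d : nat) : (\sum_(i < H) d)%N = (H * d)%N.
Proof. by rewrite sum_nat_const card_ord. Qed.

Lemma half_even (d : nat) : ~~ odd d -> (d./2 * 2)%N = d.
Proof. by move=> d_even; rewrite muln2 even_halfK. Qed.

(* MathComp gives partitioned matrices the dimension \sum_(i < H) d. The next
   three definitions only transport its block operations to dimension H * d. *)

Definition blkdiag (R : realType) (H d : nat) (B : 'I_H -> 'M[R]_d) :
    'M[R]_(H * d) :=
  castmx (sum_blocks H d, sum_blocks H d) (\mxdiag_(i < H) B i).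

Definition colblock (R : realType) (m H d : nat) (A : 'M[R]_(m, H * d))
    (i : 'I_H) : 'M[R]_(m, d) :=
  submxrow (q_ := fun=> d) (castmx (erefl m, esym (sum_blocks H d)) A) i.

Definition hcat (R : realType) (m H d : nat) (B : 'I_H -> 'M[R]_(m, d)) :
    'M[R]_(m, H * d) :=
  castmx (erefl m, sum_blocks H d) (\mxrow_(i < H) B i).

Definition orthogonal_mx (R : realType) (n : nat) (S : 'M[R]_n) : Prop :=
  S^T *m S = 1%:M.

Definition rot (R : realType) (t : R) : 'M[R]_2 :=
  \matrix_(a < 2, b < 2)
    nth 0 (nth [::] [:: [:: cos t; - sin t];
                        [:: sin t;   cos t]] a) b.

Definition rope (R : realType) (d : nat) (d_even : ~~ odd d)
    (omega : 'I_(d./2) -> R) (p : nat) : 'M[R]_d :=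
  castmx (half_even d_even, half_even d_even)
    (blkdiag (fun k => rot (omega k * p%:R))).

(* Rows and positions are numbered from 1, whereas 'I_L starts at 0. *)
Definition position (L : nat) (r : 'I_L) : nat := r.+1.

Definition rope_rows (R : realType) (L d : nat) (d_even : ~~ odd d)
    (omega : 'I_(d./2) -> R) (A : 'M[R]_(L, d)) : 'M[R]_(L, d) :=
  \matrix_(r < L) (row r A *m (rope d_even omega (position r))^T).

Definition softmax (R : realType) (m n : nat) (A : 'M[R]_(m, n)) :
    'M[R]_(m, n) :=
  \matrix_(i < m, j < n) (expR (A i j) / \sum_(k < n) expR (A i k)).

Definition rope_gqa (R : realType) (L dmodel d HQ HKV : nat)
    (d_even : ~~ odd d) (omega : 'I_(d./2) -> R) (pi : 'I_HQ -> 'I_HKV)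
    (WQ : 'M[R]_(dmodel, HQ * d)) (WK WV : 'M[R]_(dmodel, HKV * d))
    (WO : 'M[R]_(HQ * d, dmodel)) (X : 'M[R]_(L, dmodel)) :
    'M[R]_(L, dmodel) :=
  let Q := colblock (X *m WQ) in
  let K := colblock (X *m WK) in
  let V := colblock (X *m WV) in
  let Qrot i := rope_rows d_even omega (Q i) in
  let Krot j := rope_rows d_even omega (K j) in
  let A i := softmax ((Num.sqrt d%:R)^-1 *: (Qrot i *m (Krot (pi i))^T)) in
  let O i := A i *m V (pi i) in
  hcat O *m WO.

(* Main.v *)
Require Import Defs.
From mathcomp Require Import all_boot all_order all_algebra.
From mathcomp Require Import reals sequences trigo.

Set Implicit Arguments.
Unset Strict Implicit.
Unset Printing Implicit Defensive.

Import Order.TTheory GRing.Theory Num.Theory.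
Local Open Scope ring_scope.

(** An orthogonal [S] commuting with the RoPE operators also commutes with their
    transposes, so reparameterizing a head multiplies its rotated queries and keys
    by the same [S] on the right; [S] cancels in the scores, and the factor it
    leaves on the values is undone by the block [S^T] of [U^T]. *)

Lemma castmx_mulmx (R : realType) (m n p n' p' : nat)
    (en : n = n') (ep : p = p')
    (A : 'M[R]_(m, n)) (B : 'M[R]_(n, p)) :
  castmx (erefl m, en) A *m castmx (en, ep) B
  = castmx (erefl m, ep) (A *m B).
Proof. by case: n' / en; case: p' / ep. Qed.

Section Blocks.

Variables (R : realType) (H d : nat).
Implicit Types B C : 'I_H -> 'M[R]_d.

Lemma eq_hcat (m : nat) (O O' : 'I_H -> 'M[R]_(m, d)) :
  O =1 O' -> hcat O = hcat O'.
Proof. by move=> eqO; congr castmx; apply: eq_mxrow. Qed.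

Lemma hcatK (m : nat) (O : 'I_H -> 'M[R]_(m, d)) : colblock (hcat O) =1 O.
Proof. by move=> i; rewrite /colblock (castmxK (erefl m)) mxrowK. Qed.

Lemma colblockK (m : nat) (A : 'M[R]_(m, H * d)) : hcat (colblock A) = A.
Proof. by rewrite /hcat /colblock submxrowK (castmxKV (erefl m)). Qed.

Lemma tr_blkdiag B : (blkdiag B)^T = blkdiag (fun i => (B i)^T).
Proof. by rewrite /blkdiag trmx_cast tr_mxdiag. Qed.

Lemma hcat_mul_blkdiag (m : nat) (O : 'I_H -> 'M[R]_(m, d)) B :
  hcat O *m blkdiag B = hcat (fun i => O i *m B i).
Proof. by rewrite /hcat /blkdiag castmx_mulmx mul_mxrow_mxdiag. Qed.

(** This carries a reparameterization of the projection weights to each head separately. *)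
Lemma colblock_mul_blkdiag (m : nat) (A : 'M[R]_(m, H * d)) B (i : 'I_H) :
  colblock (A *m blkdiag B) i = colblock A i *m B i.
Proof. by rewrite -{1}(colblockK A) hcat_mul_blkdiag hcatK. Qed.

End Blocks.

(** Transposing the commutation relation gives [P^T *m S^T = S^T *m P^T]; multiplying by [S] on both
    sides then cancels [S^T] against [S], on the right in one member and on the left in the
    other. *)
Lemma orthogonal_mx_comm_tr (R : realType) (n : nat) (S P : 'M[R]_n) :
  orthogonal_mx S -> S *m P = P *m S -> S *m P^T = P^T *m S.
Proof.
move=> StS SP; have SSt := mulmx1C StS.
have : S *m (P^T *m S^T) *m S = S *m (S^T *m P^T) *m S.
  by rewrite -!trmx_mul SP.
by rewrite !mulmxA SSt mul1mx -!mulmxA StS mulmx1.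
Qed.

(** The rotation varies with the row while [S] does not, so moving [S] past the transposed rotation
    in each row pulls it out of the whole matrix. *)
Lemma rope_rows_mul_orthogonal (R : realType) (L d : nat) (d_even : ~~ odd d)
    (omega : 'I_(d./2) -> R) (A : 'M[R]_(L, d)) (S : 'M[R]_d) :
  orthogonal_mx S ->
  (forall r : 'I_L, S *m rope d_even omega (position r)
                    = rope d_even omega (position r) *m S) ->
  rope_rows d_even omega (A *m S) = rope_rows d_even omega A *m S.
Proof.
move=> S_orth S_comm; apply/row_matrixP => r.
by rewrite row_mul !rowK row_mul -!mulmxA orthogonal_mx_comm_tr.
Qed.

Theorem mainTheorem4 (R : realType) (L dmodel d HQ HKV : nat)
    (L_gt0 : (0 < L)%N) (dmodel_gt0 : (0 < dmodel)%N) (d_gt0 : (0 < d)%N)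
    (HQ_gt0 : (0 < HQ)%N) (HKV_gt0 : (0 < HKV)%N)
    (d_even : ~~ odd d) (omega : 'I_(d./2) -> R)
    (pi : 'I_HQ -> 'I_HKV)
    (WQ : 'M[R]_(dmodel, HQ * d)) (WK WV : 'M[R]_(dmodel, HKV * d))
    (WO : 'M[R]_(HQ * d, dmodel))
    (S : 'I_HKV -> 'M[R]_d)
    (S_orthogonal : forall j : 'I_HKV, orthogonal_mx (S j))
    (S_commutes : forall (j : 'I_HKV) (r : 'I_L),
       S j *m rope d_even omega (position r)
       = rope d_even omega (position r) *m S j) :
  let SKV := blkdiag S in
  let U := blkdiag (fun i : 'I_HQ => S (pi i)) in
  let WQ' := WQ *m U in
  let WK' := WK *m SKV in
  let WV' := WV *m SKV in
  let WO' := U^T *m WO in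
  forall X : 'M[R]_(L, dmodel),
    rope_gqa d_even omega pi WQ' WK' WV' WO' X
    = rope_gqa d_even omega pi WQ WK WV WO X.
Proof.
move=> SKV U WQ' WK' WV' WO' X.
(* Once [U^T] acts on the concatenated heads, both sides end in the same factor [WO], and one
   identity per head remains. *)
rewrite /rope_gqa /WO' mulmxA /U tr_blkdiag hcat_mul_blkdiag.
congr (_ *m _); apply: eq_hcat => i.
have SSt : S (pi i) *m (S (pi i))^T = 1%:M := mulmx1C (S_orthogonal (pi i)).
rewrite /WQ' /WK' /WV' !(mulmxA X) !colblock_mul_blkdiag.
rewrite !rope_rows_mul_orthogonal // trmx_mul.
(* Right association puts [S *m S^T] together only after the values; in the scores [S^T] is grouped
   with the keys and must be regrouped before it cancels. *)
rewrite -!mulmxA SSt mulmx1.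
by rewrite (mulmxA (S _)) SSt mul1mx.
Qed.
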